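(* Let $n\ge 1$, $\mu\in\mathbb{R}$, $\tau>0$, let $Q$ be an $n\times n$ correlation matrix, and let $Z=(z_{ik})_{1\le i\le n,\,k\ge 1}$ be the binary matrix generated by the spatially dependent Indian buffet process (sIBP) with parameters $\mu,\tau,Q$. Define $$ \delta_p=\int_{-\infty}^{\infty}\sigma(x)^p\,\phi(x;\mu,\tau^{-1})\,dx,\qquad p=1,2, $$ where $\sigma(x)=1/(1+e^{-x})$ and $\phi(\cdot;\mu,\tau^{-1})$ is the density of the normal distribution with mean $\mu$ and variance $\tau^{-1}$. Then for each $i=1,\ldots,n$: (1) (sparsity) $\mathbb{P}(z_{ik}=1)\to 0$ as $k\to\infty$; (2) writing $c_i=c_i^{(k)}=\sum_{j=1}^k z_{ij}$ for the number of features among the first $k$ possessed by subject $i$, $$ \lim_{k\to\infty}\mathbb{E}[c_i^{(k)}]=\frac{\delta_1}{1-\delta_1} $$ and $$ \lim_{k\to\infty}\mathrm{Var}(c_i^{(k)})=\frac{\delta_1}{1-\delta_1}\left(1+\frac{2\delta_2}{1-\delta_2}-\frac{\delta_1}{1-\delta_1}\right). $$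
   Context: The sIBP with parameters $(\mu,\tau,Q)$: for $k=1,2,\ldots$ let $u_k=(u_{1k},\ldots,u_{nk})\sim\mathcal{N}(\mu 1_n,\tau^{-1}Q)$ independently over $k$, where $1_n$ is the all-ones vector and $Q$ is a correlation matrix (positive semidefinite with unit diagonal; in applications its entries are given by a spatial correlation function evaluated at distances between locations). Set $b_{ik}=\prod_{j=1}^k\sigma(u_{ij})$. Given all the $u_{ik}$, the entries $z_{ik}\in\{0,1\}$ are conditionally independent with $z_{ik}\sim\mathrm{Bernoulli}(b_{ik})$. *)

(* Defs.v *)
From HB Require Import structures.
From mathcomp Require Import all_boot all_order all_algebra.
From mathcomp Require Import all_classical all_reals all_analysis.
From mathcomp Require Import measurable_realfun.

Set Implicit Arguments.
Unset Strict Implicit.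
Unset Printing Implicit Defensive.

Import Order.TTheory GRing.Theory Num.Theory.
Import numFieldNormedType.Exports.

Local Open Scope classical_set_scope.
Local Open Scope ring_scope.

Definition sigmoid {R : realType} (x : R) : R := 1 / (1 + expR (- x)).

(* [normal_pdf] takes the standard deviation, hence the square root of the
   variance [tau^-1]. *)
Definition delta {R : realType} (mu tau : R) (p : nat) : R :=
  \int[lebesgue_measure]_x
    (sigmoid x ^+ p * normal_pdf mu (Num.sqrt tau^-1) x).

Definition correlation_matrix {R : realType} (n : nat) (Q : 'M[R]_n) : Prop :=
  [/\ Q^T = Q,
      forall v : 'rV[R]_n, 0 <= (v *m Q *m v^T) ord0 ord0 &
      forall i : 'I_n, Q i i = 1].

(* The law N(m, v), parametrised by the variance v >= 0.  The degenerate case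
   v = 0 is the Dirac mass at m; the library's [normal_prob m 0] is instead
   the uniform law on [0, 1]. *)
Definition normal_law {R : realType} (m v : R) (B : set R) : \bar R :=
  if v == 0 then dirac m B else normal_prob m (Num.sqrt v) B.

(* The law nu is N(m, S): every linear form is normal with the corresponding
   mean and variance.  S may be singular. *)
Definition multivariate_normal {R : realType} (n : nat) (m : 'rV[R]_n)
    (S : 'M[R]_n) (nu : set (n.-tuple R) -> \bar R) : Prop :=
  forall (a : 'rV[R]_n) (B : set R), measurable B ->
    nu ((fun x : n.-tuple R => \sum_(i < n) a ord0 i * tnth x i) @^-1` B) =
    normal_law (\sum_(i < n) a ord0 i * m ord0 i)
               ((a *m S *m a^T) ord0 ord0) B.

Section independence.
Context {d d' : measure_display} {T : measurableType d} {R : realType}.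
Context (P : probability T R) {T' : measurableType d'}.
Local Open Scope ereal_scope.

Definition mutual_independence {I : choiceType} (X : I -> T -> T') : Prop :=
  forall (J : seq I) (A : I -> set T'), uniq J ->
    (forall i, measurable (A i)) ->
    P (\bigcap_(i in [set` J]) (X i @^-1` A i)) =
    \prod_(i <- J) P (X i @^-1` A i).

(* f is a version of the conditional probability P(E | G), for G a
   sub-sigma-algebra of T. *)
Definition conditional_probability (G : set (set T)) (E : set T)
    (f : T -> \bar R) : Prop :=
  (forall B : set (\bar R), measurable B -> G (f @^-1` B)) /\
  (forall A : set T, G A -> \int[P]_(w in A) f w = P (A `&` E)).

Definition conditional_law (G : set (set T)) (X : T -> T')
    (kappa : T -> set T' -> \bar R) : Prop :=
  forall B : set T', measurable B ->
    conditional_probability G (X @^-1` B) (fun w => kappa w B).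

Definition conditional_independence (G : set (set T)) {I : choiceType}
    (X : I -> T -> T') : Prop :=
  forall (J : seq I) (A : I -> set T') (f : I -> T -> \bar R), uniq J ->
    (forall i, measurable (A i)) ->
    (forall i, i \in J -> conditional_probability G (X i @^-1` A i) (f i)) ->
    conditional_probability G (\bigcap_(i in [set` J]) (X i @^-1` A i))
      (fun w => \prod_(i <- J) f i w).

End independence.

Section sIBP.
Context {d : measure_display} {T : measurableType d} {R : realType}.
Context (P : probability T R) {n : nat}.

(* Features are numbered from 0: [u k] and [z i k] stand for u_(k+1) and
   z_(i,k+1), which is why the product below has k + 1 factors. *)
Definition stick (u : nat -> T -> n.-tuple R) (i : 'I_n) (k : nat) (w : T) : R :=
  \prod_(j < k.+1) sigmoid (tnth (u j w) i).

Definition sigma_of (u : nat -> T -> n.-tuple R) : set (set T) :=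
  <<s \bigcup_k g_sigma_algebra_preimage (u k) >>.

Record sIBP (mu tau : R) (Q : 'M[R]_n) (u : nat -> {RV P >-> n.-tuple R})
    (z : 'I_n -> nat -> {RV P >-> bool}) : Prop := {
  sIBP_normal : forall k,
    multivariate_normal (const_mx mu) (tau^-1 *: Q) (distribution P (u k));
  sIBP_indep : mutual_independence P u;
  sIBP_bernoulli : forall i k,
    conditional_law P (sigma_of u) (z i k)
      (fun w => bernoulli_prob (stick u i k w));
  sIBP_cond_indep :
    conditional_independence P (sigma_of u)
      (fun (ik : 'I_n * nat) => z ik.1 ik.2 : T -> bool)
}.

Definition feature_count (z : 'I_n -> nat -> T -> bool) (i : 'I_n) (k : nat)
    (w : T) : R :=
  \sum_(j < k) (z i j w)%:R.

End sIBP.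

(* Main.v *)
Require Import Defs.
From mathcomp Require Import all_boot all_order all_algebra.
From mathcomp Require Import all_classical all_reals all_analysis.
From mathcomp Require Import measurable_realfun.
From mathcomp Require Import ring.

(** Conditioning on the sticks gives P(z_k) = E[b_k] = d1^(k+1) and, for j < k,
    P(z_j, z_k) = E[b_j b_k] = d2^(j+1) d1^(k-j), because b_j b_k is a product of
    independent factors: j+1 squares of sigmoids and k-j plain sigmoids.  Since
    z_j^2 = z_j, the first two moments of the count are a geometric sum and a
    convolution of two geometric sequences, whose limits are explicit because
    0 <= d1, d2 < 1. *)

Set Implicit Arguments.
Unset Strict Implicit.
Unset Printing Implicit Defensive.

Import Order.TTheory GRing.Theory Num.Theory.
Import numFieldNormedType.Exports.

Local Open Scope classical_set_scope.
Local Open Scope ring_scope.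

(** * Change of variables with a weight *)

Section weighted_integral.
Local Open Scope ereal_scope.
Context d1 d2 (T1 : measurableType d1) (T2 : measurableType d2) (R : realType).
Import HBNNSimple.

(** The hypothesis on preimages is the case of indicators; linearity extends it to simple functions
    and monotone convergence to nonnegative [f]. The same lemma serves for densities ([X] the
    identity), for image laws ([V] equal to 1) and for independence ([V] a product of the other
    factors). *)
Lemma ge0_integral_weighted (mu : {measure set T1 -> \bar R})
    (nu : {measure set T2 -> \bar R}) (X : T1 -> T2) (V : T1 -> R)
    (c : \bar R) (f : T2 -> \bar R) :
    measurable_fun [set: T1] X -> measurable_fun [set: T1] V ->
    (forall x, 0 <= V x)%R -> 0 <= c -> c \is a fin_num ->
    (forall A, measurable A ->
      \int[mu]_(x in X @^-1` A) (V x)%:E = c * nu A) ->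
    measurable_fun [set: T2] f -> (forall y, 0 <= f y) ->
  \int[mu]_x ((V x)%:E * f (X x)) = c * \int[nu]_y f y.
Proof.
move=> mX mV V0 c0 cfin muV mf f0.
pose g := nnsfun_approx measurableT mf.
have mgX n : measurable_fun [set: T1] (fun x => (g n (X x))%:E).
  by apply/measurable_EFinP; exact: measurableT_comp.
have intg n : \int[mu]_x ((V x)%:E * (g n (X x))%:E) = c * \int[nu]_y (g n y)%:E.
  have mgr r : measurable (X @^-1` (g n @^-1` [set r])).
    by rewrite -[X in measurable X]setTI; exact: mX.
  have r0 r : r \in range (g n) -> (0 <= r)%R.
    by rewrite inE => -[y _ <-].
  transitivity (\int[mu]_x \sum_(r \in range (g n))
      ((V x)%:E * (r * \1_(g n @^-1` [set r]) (X x))%:E)).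
    apply: eq_integral => x _; rewrite {1}(fimfunE (g n)) -fsumEFin//.
    by rewrite ge0_mule_fsumr// => y; exact: nnfun_muleindic_ge0.
  rewrite ge0_integral_fsum//; last 2 first.
  - move=> r; apply: emeasurable_funM; first exact/measurable_EFinP.
    apply/measurable_EFinP/measurable_funM => //.
    exact: measurableT_comp.
  - by move=> r x _; apply: mule_ge0; rewrite ?lee_fin//; exact: nnfun_muleindic_ge0.
  rewrite integralT_nnsfun sintegralE ge0_mule_fsumr//; last first.
    (* The sum ranges over all reals, so [r] may be negative; outside the range of [g n] the level
       set is empty and the term vanishes. *)
    move=> r; have [/r0 rge0|rn] := boolP (r \in range (g n)).
      by rewrite mule_ge0.
    rewrite preimage10 ?measure0 ?mule0//.
    by move: rn; rewrite notin_setE.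
  apply: eq_fsbigr => r /r0 rge0.
  rewrite muleCA -muV// -ge0_integralZl//; last 2 first.
  - exact/measurable_EFinP/measurable_funTS.
  - by move=> x _; rewrite lee_fin.
  rewrite [RHS]integral_mkcond; apply: eq_integral => x _.
  rewrite patchE indicE.
  have -> : (X x \in g n @^-1` [set r]) = (x \in X @^-1` (g n @^-1` [set r])).
    by [].
  case: ifPn => _; last by rewrite mulr0 mule0.
  by rewrite mulr1 muleC.
transitivity (limn (fun n => \int[mu]_x ((V x)%:E * (g n (X x))%:E))).
  rewrite -monotone_convergence//.
  - apply: eq_integral => x _; apply/esym/cvg_lim => //.
    apply: cvgeZl => //.
    exact: (@cvg_nnsfun_approx _ _ _ _ measurableT _ mf).
  - by move=> n; apply: emeasurable_funM => //; exact/measurable_EFinP.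
  - by move=> n x _; rewrite mule_ge0// lee_fin.
  - move=> x _ m n mn; rewrite lee_wpmul2l// lee_fin//.
    exact/lefP/nd_nnsfun_approx.
under eq_fun do rewrite intg.
(* Finiteness of [c] lets it leave the limit; the remaining integrals converge because they increase
   with [n]. *)
rewrite limeMl//; last first.
  apply: ereal_nondecreasing_is_cvgn => m n mn.
  apply: ge0_le_integral => //.
  - by move=> y _; rewrite lee_fin.
  - exact/measurable_EFinP.
  - exact/measurable_EFinP.
  - by move=> y _; rewrite lee_fin; exact/lefP/nd_nnsfun_approx.
congr (c * _); rewrite -monotone_convergence//.
- apply: eq_integral => y _; apply/cvg_lim => //.
  exact: (@cvg_nnsfun_approx _ _ _ _ measurableT _ mf).
- by move=> n; exact/measurable_EFinP.
- by move=> n y _; rewrite lee_fin.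
- by move=> y _ m n mn; rewrite lee_fin; exact/lefP/nd_nnsfun_approx.
Qed.

End weighted_integral.

(** * Expectation of a product of functions of independent variables *)

Section product_expectation.
Local Open Scope ereal_scope.
Context d d' (T : measurableType d) (T' : measurableType d') (R : realType).
Context (P : probability T R) (I : choiceType).

Lemma ge0_integral_prod_independent (X : I -> {RV P >-> T'}) (g : I -> T' -> R)
    (s : seq I) :
    mutual_independence P X -> uniq s ->
    (forall l, measurable_fun [set: T'] (g l)) ->
    (forall l y, 0 <= g l y)%R ->
    (forall l, \int[P]_w (g l (X l w))%:E \is a fin_num) ->
  \int[P]_w (\prod_(l <- s) g l (X l w))%:E =
  \prod_(l <- s) \int[P]_w (g l (X l w))%:E.
Proof.
move=> iX us mg g0 gfin.
have mgX l : measurable_fun [set: T] (fun w => g l (X l w)).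
  by apply: measurableT_comp => //; exact: mg.
have mXA (A : I -> set T') l : measurable (A l) -> measurable (X l @^-1` A l).
  by move=> mA; rewrite -[X in measurable X]setTI; exact: measurable_funP.
have mcap (A : I -> set T') (t : seq I) : (forall l, measurable (A l)) ->
    measurable (\bigcap_(l in [set` t]) (X l @^-1` A l)).
  move=> mA; rewrite bigcap_seq; apply: big_ind => // [|l _].
    exact: measurableI.
  exact: mXA.
(* Replace the indicators of the events [X l \in A l] by the functions [g l]
   one index at a time. *)
suff gen (t : seq I) (A : I -> set T') : uniq (s ++ t) ->
    (forall l, measurable (A l)) ->
    \int[P]_(w in \bigcap_(l in [set` t]) (X l @^-1` A l))
      (\prod_(l <- s) g l (X l w))%:E =
    \prod_(l <- s) \int[P]_w (g l (X l w))%:E *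
    \prod_(l <- t) P (X l @^-1` A l).
  have := gen [::] (fun=> setT); rewrite cats0 big_nil mule1 => <- //.
  congr integral; apply/esym/seteqP; by split=> // w _ l.
elim: s us t A => [|l s IH] /= us t A ust mA.
  rewrite big_nil mul1e -iX//.
  under eq_integral do rewrite big_nil.
  by rewrite integral_cst ?mul1e//; exact: mcap.
move: us ust => /andP[ls us] /andP[].
rewrite mem_cat negb_or => /andP[_ lt] ust.
have V0 w : (0 <= \prod_(l <- s) g l (X l w))%R by exact: prodr_ge0.
have mV : measurable_fun [set: T] (fun w => \prod_(l <- s) g l (X l w))%R.
  exact: measurable_prod.
pose B := \bigcap_(l in [set` t]) (X l @^-1` A l).
have mB : measurable B by exact: mcap.
pose c := \prod_(l <- s) \int[P]_w (g l (X l w))%:E * \prod_(l <- t) P (X l @^-1` A l).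
(* The factor [l] is integrated against the law of [X l], while everything else, the indicator of
   [B] included, becomes the weight. Its total mass is [c], finite because each expectation is. *)
transitivity (c * \int[distribution P (X l)]_y (g l y)%:E); last first.
  rewrite ge0_integral_distribution//; last 2 first.
  - exact/measurable_EFinP.
  - by move=> y; rewrite lee_fin.
  by rewrite big_cons /c muleC muleA.
rewrite -(@ge0_integral_weighted _ _ _ _ _ P _ (X l)
  (fun w => (\1_B w * \prod_(l <- s) g l (X l w))%R))//.
- rewrite [LHS]integral_mkcond; apply: eq_integral => w _.
  rewrite patchE indicE -/B; case: ifPn => _; last by rewrite mul0r mul0e.
  by rewrite mul1r big_cons EFinM muleC.
- by apply: measurable_funM => //; exact: measurable_indic.
- by move=> w; rewrite mulr_ge0.
- rewrite /c mule_ge0//.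
    apply: (big_ind (fun x => 0 <= x)) => // [x y|k _]; first exact: mule_ge0.
    by apply: integral_ge0 => w _; rewrite lee_fin.
  by apply: (big_ind (fun x => 0 <= x)) => // x y; exact: mule_ge0.
- rewrite /c fin_numM//.
    by apply: (big_ind (fun x => x \is a fin_num)) => // x y; exact: fin_numM.
  apply: (big_ind (fun x => x \is a fin_num)) => // [x y|k _]; first exact: fin_numM.
  by apply: fin_num_measure; exact: mXA.
- move=> C mC.
  (* The weighted identity on the event that [X l] lies in [C] is the induction hypothesis with [l]
     moved to the list of events; uniqueness of the indices keeps the other events unchanged. *)
  pose A' k := if k == l then C else A k.
  have mA' k : measurable (A' k) by rewrite /A'; case: ifP.
  have {}IH := IH us (l :: t) A'.
  have tA' k : k \in t -> A' k = A k.
    by move=> kt; rewrite /A'; case: eqP => // kl; rewrite -kl kt in lt.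
  transitivity (\int[P]_(w in \bigcap_(k in [set` l :: t]) (X k @^-1` A' k))
      (\prod_(l <- s) g l (X l w))%:E).
    have -> : \bigcap_(k in [set` l :: t]) (X k @^-1` A' k) =
        (X l @^-1` C) `&` B.
      rewrite bigcap_seq big_cons /B bigcap_seq {1}/A' eqxx; congr (_ `&` _).
      by apply: eq_big_seq => k /tA' ->.
    rewrite integral_mkcondr; apply: eq_integral => w _.
    rewrite patchE indicE; case: ifPn => _; first by rewrite mul1r.
    by rewrite mul0r.
  rewrite IH//; last first.
    rewrite (perm_uniq (permEl (perm_catCA s [:: l] t)))/=.
    by rewrite mem_cat negb_or ls lt ust.
  rewrite big_cons {1}/A' eqxx /c /distribution /pushforward muleA [RHS]muleAC.
  congr (_ * _); apply: eq_big_seq => k kt.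
  by rewrite tA'.
- exact/measurable_EFinP.
- by move=> y; rewrite lee_fin.
Qed.

End product_expectation.

(** * Bounds and measurability of the sigmoid *)

Section sigmoid.
Context {R : realType}.
Implicit Types x : R.

Lemma sigmoid_gt0 x : 0 < sigmoid x.
Proof. by rewrite /sigmoid divr_gt0// addr_gt0// expR_gt0. Qed.

Lemma sigmoid_lt1 x : sigmoid x < 1.
Proof.
by rewrite /sigmoid ltr_pdivrMr ?mul1r ?ltrDl ?expR_gt0// addr_gt0// expR_gt0.
Qed.

Lemma measurable_sigmoid : measurable_fun [set: R] (@sigmoid R).
Proof.
apply: continuous_measurable_fun => x; rewrite /sigmoid.
apply: cvgM; first exact: cvg_cst.
apply: cvgV; first by rewrite gt_eqF// addr_gt0// expR_gt0.
apply: cvgD; first exact: cvg_cst.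
apply: continuous_comp; first exact: opp_continuous.
exact: continuous_expR.
Qed.

Lemma measurable_sigmoidX p : measurable_fun [set: R] (fun x => sigmoid x ^+ p).
Proof. by apply: measurable_funX; exact: measurable_sigmoid. Qed.

End sigmoid.

(** * The moments [delta] as expectations under the normal law *)

Section delta.
Context {R : realType} (mu tau : R).

Let integral_normal_prob1 (s : R) : (\int[normal_prob mu s]_x 1 = 1)%E.
Proof.
rewrite integral_cst// mul1e; exact: (probability_setT (normal_prob mu s)).
Qed.

Lemma integral_normal_prob_sigmoidX p :
  (\int[normal_prob mu (Num.sqrt tau^-1)]_x (sigmoid x ^+ p)%:E)%E =
  (delta mu tau p)%:E.
Proof.
set s := Num.sqrt tau^-1.
have nuE : (\int[lebesgue_measure]_x (sigmoid x ^+ p * normal_pdf mu s x)%:E)%E =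
    (\int[normal_prob mu s]_x (sigmoid x ^+ p)%:E)%E.
  have := @ge0_integral_weighted _ _ _ _ R lebesgue_measure (normal_prob mu s)
    id (normal_pdf mu s) 1%E (fun x => (sigmoid x ^+ p)%:E).
  rewrite mul1e => <- //.
  - by apply: eq_integral => x _; rewrite EFinM muleC.
  - exact: measurable_normal_pdf.
  - by move=> x; exact: normal_pdf_ge0.
  - by move=> A mA; rewrite mul1e.
  - by apply/measurable_EFinP; exact: measurable_sigmoidX.
  - by move=> x; rewrite lee_fin exprn_ge0// ltW// sigmoid_gt0.
(* [Rintegral] would send an infinite integral to 0, so finiteness must be checked; it follows from
   [sigmoid x ^+ p <= 1] under a probability measure. *)
rewrite /delta /Rintegral -/s nuE fineK//.
rewrite ge0_fin_numE; last first.
  by apply: integral_ge0 => x _; rewrite lee_fin exprn_ge0// ltW// sigmoid_gt0.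
apply: (@le_lt_trans _ _ (\int[normal_prob mu s]_x 1)%E).
  apply: ge0_le_integral => //.
  - by move=> x _; rewrite lee_fin exprn_ge0// ltW// sigmoid_gt0.
  - by apply/measurable_EFinP; exact: measurable_sigmoidX.
  - move=> x _; rewrite lee_fin exprn_ile1 ?ltW ?sigmoid_gt0 ?sigmoid_lt1//.
by rewrite integral_normal_prob1 ltry.
Qed.

Lemma delta_ge0 p : 0 <= delta mu tau p.
Proof.
rewrite -lee_fin -integral_normal_prob_sigmoidX.
by apply: integral_ge0 => x _; rewrite lee_fin exprn_ge0// ltW// sigmoid_gt0.
Qed.

(** The function [1 - sigmoid x ^+ p] is positive everywhere, so its integral against a probability
    measure cannot vanish: otherwise the whole space would be a null set. *)
Lemma delta_lt1 p : (0 < p)%N -> delta mu tau p < 1.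
Proof.
move=> p0; set nu := normal_prob mu (Num.sqrt tau^-1).
have sp (x : R) : 0 <= sigmoid x ^+ p by rewrite exprn_ge0// ltW// sigmoid_gt0.
have sp1 (x : R) : sigmoid x ^+ p < 1.
  by rewrite exprn_ilt1 ?ltW ?sigmoid_gt0 ?sigmoid_lt1// -lt0n.
have mc : measurable_fun [set: R] (fun x : R => (1 - sigmoid x ^+ p)%:E).
  by apply/measurable_EFinP/measurable_funB => //; exact: measurable_sigmoidX.
have dE : (\int[nu]_x (1 - sigmoid x ^+ p)%:E + (delta mu tau p)%:E = 1)%E.
  rewrite -integral_normal_prob_sigmoidX -ge0_integralD//.
  - under eq_integral do rewrite -EFinD subrK.
    exact: integral_normal_prob1.
  - by move=> x _; rewrite lee_fin subr_ge0 (ltW (sp1 x)).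
  - by move=> x _; rewrite lee_fin.
  - by apply/measurable_EFinP; exact: measurable_sigmoidX.
rewrite -lte_fin -dE lteDr// lt_neqAle eq_sym; apply/andP; split; last first.
  by apply: integral_ge0 => x _; rewrite lee_fin subr_ge0 (ltW (sp1 x)).
apply/eqP => c0.
have /ae_eq_integral_abs : (\int[nu]_x `|(1 - sigmoid x ^+ p)%:E| = 0)%E.
  rewrite -c0; apply: eq_integral => x _.
  by rewrite gee0_abs// lee_fin subr_ge0 (ltW (sp1 x)).
case=> // N [mN N0 NT].
have : nu setT = 0%E.
  apply: (subset_measure0 _ mN) => // x _; apply: NT => /(_ Logic.I) [].
  by apply/eqP; rewrite subr_eq0 gt_eqF.
have -> : nu setT = 1%E by exact: (probability_setT nu).
by move/eqP; rewrite onee_eq0.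
Qed.

End delta.

(** * Feature probabilities and the first two moments of the count *)

Section sIBP_moments.
Context {R : realType} {d : measure_display} {T : measurableType d}.
Context {P : probability T R} {n : nat} {mu tau : R} {Q : 'M[R]_n}.
Context {u : nat -> {RV P >-> n.-tuple R}} {z : 'I_n -> nat -> {RV P >-> bool}}.
Hypotheses (htau : 0 < tau) (hQ : correlation_matrix Q) (hZ : sIBP mu tau Q u z).
Variable i : 'I_n.
Local Notation d1 := (delta mu tau 1).
Local Notation d2 := (delta mu tau 2).

(** Take the linear form given by the [i]-th basis vector: its variance is
    [tau^-1 * Q i i = tau^-1], which is positive, so [normal_law] is not in its Dirac case. *)
Lemma coordinate_normal k (B : set R) : measurable B ->
  P ((fun w => tnth (u k w) i) @^-1` B) = normal_prob mu (Num.sqrt tau^-1) B.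
Proof.
move=> mB; have := sIBP_normal hZ k (delta_mx ord0 i) mB.
have coordE (x : 'I_n -> R) : \sum_(j < n) delta_mx ord0 i ord0 j * x j = x i.
  rewrite (bigD1 i)//= mxE !eqxx mul1r big1 ?addr0// => j ji.
  by rewrite mxE (negbTE ji) andbF mul0r.
rewrite coordE -rowE trmx_delta -colE !mxE.
have [_ _ ->] := hQ; rewrite mulr1 /normal_law gt_eqF ?invr_gt0// => <-.
rewrite /distribution /pushforward; congr (P _).
by apply/seteqP; split=> w /=; rewrite coordE.
Qed.

Lemma integral_coordinate_sigmoidX k p :
  (\int[P]_w (sigmoid (tnth (u k w) i) ^+ p)%:E)%E = (delta mu tau p)%:E.
Proof.
rewrite -integral_normal_prob_sigmoidX.
have mY : measurable_fun [set: T] (fun w => tnth (u k w) i).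
  by apply: (measurableT_comp (measurable_tnth i)); exact: measurable_funPT.
have := @ge0_integral_weighted _ _ _ _ R P (normal_prob mu (Num.sqrt tau^-1))
  (fun w => tnth (u k w) i) (cst 1) 1%E (fun x => (sigmoid x ^+ p)%:E).
rewrite mul1e => <- //.
- by apply: eq_integral => w _; rewrite mul1e.
- move=> A mA.
  have mYA : measurable ((fun w => tnth (u k w) i) @^-1` A).
    by rewrite -[X in measurable X]setTI; exact: mY.
  by apply: etrans (integral_cst P mYA 1%E) _; rewrite !mul1e; exact: coordinate_normal.
- by apply/measurable_EFinP; exact: measurable_sigmoidX.
- by move=> x; rewrite lee_fin exprn_ge0// ltW// sigmoid_gt0.
Qed.

(** Exponents may vary with the stage, so that one formula covers both a single stick and a product
    of two sticks. *)
Lemma integral_prod_sigmoidX m (p : nat -> nat) :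
  (\int[P]_w (\prod_(l < m) sigmoid (tnth (u l w) i) ^+ p l)%:E)%E =
  (\prod_(l < m) delta mu tau (p l))%:E.
Proof.
pose g l (x : n.-tuple R) := sigmoid (tnth x i) ^+ p l.
rewrite -(big_mkord xpredT (fun l => delta mu tau (p l))) -prodEFin.
under [RHS]eq_bigr => l _ do rewrite -(integral_coordinate_sigmoidX l).
under eq_integral => w _ do
  rewrite -(big_mkord xpredT (fun l => sigmoid (tnth (u l w) i) ^+ p l)).
apply: (@ge0_integral_prod_independent _ _ _ _ _ P _ u g) => [||l|l y|l].
- exact: sIBP_indep hZ.
- exact: iota_uniq.
- apply: (measurableT_comp (measurable_sigmoidX (p l))).
  exact: measurable_tnth.
- by rewrite exprn_ge0// ltW// sigmoid_gt0.
- by rewrite integral_coordinate_sigmoidX.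
Qed.

Lemma stick_ge0 k w : 0 <= stick u i k w.
Proof. by apply: prodr_ge0 => j _; rewrite ltW// sigmoid_gt0. Qed.

Lemma stick_le1 k w : stick u i k w <= 1.
Proof.
by apply: prodr_ile1 => j _; rewrite !ltW ?sigmoid_gt0 ?sigmoid_lt1.
Qed.

Lemma bernoulli_prob_stick k w :
  bernoulli_prob (stick u i k w) [set true] = (stick u i k w)%:E.
Proof.
rewrite bernoulli_probE ?stick_ge0 ?stick_le1// !diracE mem_set// memNset//.
by rewrite mule1 mule0 adde0.
Qed.

(** Integrating a conditional probability over the whole space, an event of the conditioning
    sigma-algebra, gives the unconditional probability. *)
Let sigma_of_setT : sigma_of u [set: T].
Proof.
have [G0 GD _] := smallest_sigma_algebra [set: T]
  (\bigcup_k g_sigma_algebra_preimage (u k)).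
by rewrite -(setD0 setT); exact: GD.
Qed.

Local Notation has k := (z i k @^-1` [set true]).

Lemma prob_feature k : P (has k) = (d1 ^+ k.+1)%:E.
Proof.
have [//|_ /(_ _ sigma_of_setT)] := sIBP_bernoulli hZ i k (B := [set true]).
rewrite setTI => <-; under eq_integral do rewrite bernoulli_prob_stick.
rewrite /stick; under eq_integral do under eq_bigr do rewrite -[sigmoid _]expr1.
by rewrite (integral_prod_sigmoidX _ (fun=> 1%N)) prodr_const card_ord.
Qed.

(** The stages up to [j] occur in both sticks and the later ones only in the longer; the exponent
    reads the boolean [l <= j] as 0 or 1 and adds 1. *)
Lemma stickM j k w : (j < k)%N ->
  stick u i j w * stick u i k w =
  \prod_(l < k.+1) sigmoid (tnth (u l w) i) ^+ (l <= j)%N.+1.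
Proof.
move=> jk; rewrite /stick (big_ord_widen k.+1
  (fun l => sigmoid (tnth (u l w) i))) 1?ltnW// big_mkcond/= -big_split/=.
by apply: eq_bigr => l _; rewrite ltnS; case: ifP => _; rewrite ?mul1r ?expr2.
Qed.

Lemma prob_feature2 j k : (j < k)%N ->
  P (has j `&` has k) = (d2 ^+ j.+1 * d1 ^+ (k - j))%:E.
Proof.
move=> jk.
(* The Bernoulli kernels are the chosen versions of the conditional probabilities; the product of
   the two is integrated over the whole space. *)
have [_ /(_ _ sigma_of_setT)] := sIBP_cond_indep hZ
  (J := [:: (i, j); (i, k)]) (A := fun=> [set true])
  (f := fun ik w => bernoulli_prob (stick u ik.1 ik.2 w) [set true])
  ltac:(by rewrite /= inE xpair_eqE eqxx ltn_eqF) (fun=> Logic.I)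
  (fun ik _ => sIBP_bernoulli hZ ik.1 ik.2 Logic.I).
rewrite setTI bigcap_seq !big_cons big_nil setIT => <-.
under eq_integral do
  rewrite !big_cons big_nil !bernoulli_prob_stick mule1 -EFinM stickM//.
rewrite (integral_prod_sigmoidX _ (fun l => (l <= j)%N.+1)).
rewrite -(big_mkord xpredT (fun l => delta mu tau (l <= j)%N.+1)).
(* Cutting after stage [j] leaves [j.+1] factors [d2] and [k - j] factors [d1]. *)
rewrite (big_cat_nat _ _ (n := j.+1))//=; last exact: ltnW.
rewrite (eq_big_nat _ _ (F2 := fun=> d2)); last first.
  by move=> l /andP[_]; rewrite ltnS => ->.
rewrite [X in _ * X](eq_big_nat _ _ (F2 := fun=> d1)); last first.
  by move=> l /andP[jl _]; rewrite leqNgt jl.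
by rewrite !prodr_const_nat subn0 subSS.
Qed.

Let z_indic k w : (z i k w)%:R = \1_(has k) w :> R.
Proof.
rewrite indicE; have [zw|zw] := boolP (z i k w); first by rewrite mem_set.
by rewrite memNset//= => zw'; rewrite zw' in zw.
Qed.

Let measurable_has k : measurable (has k).
Proof. by rewrite -[X in measurable X]setTI; exact: measurable_funPT. Qed.

Lemma measurable_feature_count k :
  measurable_fun [set: T] (feature_count z i k : T -> R).
Proof.
apply: measurable_sum => j; under eq_fun do rewrite z_indic.
exact: measurable_indic.
Qed.

Lemma expectation_feature_count k :
  ('E_P[feature_count z i k])%E = (\sum_(m < k) d1 ^+ m.+1)%:E.
Proof.
rewrite unlock /feature_count.
under eq_integral do rewrite -sumEFin.
rewrite ge0_integral_sum//; last first.
  move=> j; apply/measurable_EFinP; under eq_fun do rewrite z_indic.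
  exact: measurable_indic.
rewrite -sumEFin; apply: eq_bigr => j _; rewrite -prob_feature.
by under eq_integral do rewrite z_indic; rewrite integral_indic ?setIT.
Qed.

(** The double sum is grouped by its larger index [m]: the diagonal gives the indicator itself, and
    each pair [j < m] is counted twice. *)
Lemma feature_count_sqr k w :
  feature_count z i k w ^+ 2 =
  \sum_(m < k) (\1_(has m) w + \sum_(j < m) 2 * \1_(has j `&` has m) w) :> R.
Proof.
rewrite /feature_count; elim: k => [|k IH]; first by rewrite !big_ord0 expr0n.
rewrite !big_ord_recr/= -IH sqrrD -addrA; congr (_ + _); rewrite addrC.
congr (_ + _); first by rewrite -z_indic; case: (z i k w); rewrite ?expr1n ?expr0n.
rewrite -mulr_natl mulr_suml mulr_sumr; apply: eq_bigr => j _.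
by rewrite indicI/= !z_indic.
Qed.

Lemma expectation_feature_count_sqr k :
  ('E_P[fun w => feature_count z i k w ^+ 2]%R)%E =
  (\sum_(m < k) d1 ^+ m.+1 +
   2 * \sum_(m < k) \sum_(j < m) d2 ^+ j.+1 * d1 ^+ (m - j))%:E.
Proof.
have mI j m : measurable_fun [set: T] (fun w => (2 * \1_(has j `&` has m) w)%:E : \bar R).
  apply/measurable_EFinP/measurable_funM => //.
  by apply: measurable_indic; exact: measurableI.
have mS m : measurable_fun [set: T]
    (fun w => (\sum_(j < m) (2 * \1_(has j `&` has m) w)%:E)%E : \bar R).
  exact: emeasurable_sum.
have mh m : measurable_fun [set: T] (fun w => (\1_(has m) w)%:E : \bar R).
  by apply/measurable_EFinP; exact: measurable_indic.
rewrite unlock.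
under eq_integral.
  move=> w _; rewrite feature_count_sqr -sumEFin.
  under eq_bigr do rewrite EFinD -sumEFin.
  over.
rewrite ge0_integral_sum//; last 2 first.
- by move=> m; exact: emeasurable_funD.
- move=> m w _; apply: adde_ge0; first by rewrite lee_fin.
  by apply: sume_ge0 => j _; rewrite lee_fin mulr_ge0.
rewrite mulr_sumr -big_split/= -sumEFin; apply: eq_bigr => m _.
rewrite ge0_integralD//; last 2 first.
- by move=> w _; apply: sume_ge0 => j _; rewrite lee_fin mulr_ge0.
- exact: mS.
rewrite EFinD; congr (_ + _)%E.
  by rewrite integral_indic// setIT; exact: prob_feature.
rewrite ge0_integral_sum//.
rewrite mulr_sumr -sumEFin; apply: eq_bigr => j _.
have mjm : measurable (has j `&` has m) by exact: measurableI.
under eq_integral do rewrite EFinM.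
rewrite ge0_integralZl//; last first.
  by apply/measurable_EFinP; exact: measurable_indic.
rewrite integral_indic// setIT EFinM; congr (_ * _)%E; exact: prob_feature2.
Qed.

Lemma variance_feature_count k :
  ('V_P[feature_count z i k])%E =
  (\sum_(m < k) d1 ^+ m.+1 +
   2 * (\sum_(m < k) \sum_(j < m) d2 ^+ j.+1 * d1 ^+ (m - j)) -
   (\sum_(m < k) d1 ^+ m.+1) ^+ 2)%:E.
Proof.
have fc0 w : 0 <= feature_count z i k w :> R by exact: sumr_ge0.
have fck w : feature_count z i k w <= k%:R :> R.
  rewrite -[X in X%:R]card_ord -sumr_const; apply: ler_sum => j _.
  by case: (z i j w).
(* The covariance formula needs integrability of the count and of its square; both are bounded for
   fixed [k]. *)
have bound (f : T -> R) (M : R) : measurable_fun [set: T] f ->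
    (forall w, `|f w| <= M) -> f \in Lfun P 1.
  move=> mf fM; apply/Lfun1_integrable/measurable_bounded_integrable => //.
    exact: (le_lt_trans (probability_le1 P measurableT) (ltry _)).
  exists M; split; first exact: num_real.
  by move=> N MN w _; exact: le_trans (fM w) (ltW MN).
have mfc := measurable_feature_count k.
rewrite /variance covarianceE; last 3 first.
- by apply: (bound _ k%:R) => // w; rewrite ger0_norm.
- by apply: (bound _ k%:R) => // w; rewrite ger0_norm.
- apply: (bound _ (k%:R * k%:R)); first exact: measurable_funM.
  by move=> w; rewrite ger0_norm ?mulr_ge0// ler_pM.
rewrite expectation_feature_count -EFinM -expr2 EFinB.
by rewrite -expectation_feature_count_sqr.
Qed.

End sIBP_moments.

(** * Limits of the geometric sum and of the convolution *)

Section limits.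
Context {R : realType}.
Implicit Types x y : R.

Lemma cvg_sum_exprS x : 0 <= x < 1 ->
  \sum_(m < k) x ^+ m.+1 @[k --> \oo] --> x / (1 - x).
Proof.
move=> /andP[x0 x1].
have -> : (fun k => \sum_(m < k) x ^+ m.+1) = series (geometric x x).
  apply/funext => k; rewrite seriesEord.
  by apply: eq_bigr => j _; rewrite /= exprS.
by apply: cvg_geometric_series; rewrite ger0_norm.
Qed.

(** No Cauchy product is formed: the recurrence [r m.+1 = x * (r m + y ^+ m.+1)] sums to
    [(1 - x) * S k = x * G k - r k], and it remains to see that [r] tends to 0. *)
Lemma cvg_sum_convolution x y : 0 <= x < 1 -> 0 <= y < 1 ->
  \sum_(m < k) \sum_(j < m) y ^+ j.+1 * x ^+ (m - j) @[k --> \oo] -->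
  x / (1 - x) * (y / (1 - y)).
Proof.
move=> x01 y01; have /andP[x0 x1] := x01; have /andP[y0 y1] := y01.
pose r m := \sum_(j < m) y ^+ j.+1 * x ^+ (m - j).
pose S k := \sum_(m < k) r m; pose G k := \sum_(m < k) y ^+ m.+1.
have r0 m : 0 <= r m by apply: sumr_ge0 => j _; rewrite mulr_ge0 ?exprn_ge0.
have rS m : r m.+1 = x * (r m + y ^+ m.+1).
  rewrite /r big_ord_recr/= subSnn expr1 mulrDr [x * y ^+ _]mulrC.
  congr (_ + _); rewrite mulr_sumr; apply: eq_bigr => j _.
  by rewrite subSn 1?ltnW// [x ^+ _.+1]exprS mulrCA.
have SG k : (1 - x) * S k = x * G k - r k.
  elim: k => [|k IH]; first by rewrite /S /G /r !big_ord0 !mulr0 subr0.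
  have -> : S k.+1 = S k + r k by rewrite /S big_ord_recr.
  have -> : G k.+1 = G k + y ^+ k.+1 by rewrite /G big_ord_recr.
  by rewrite mulrDr IH rS; ring.
have cG : G k @[k --> \oo] --> y / (1 - y) by exact: cvg_sum_exprS.
have G_ub k : G k <= y / (1 - y).
  rewrite -(cvg_lim _ cG)//; apply: nondecreasing_cvgn_le; last exact: cvgP cG.
  apply/nondecreasing_seqP => m.
  by rewrite /G big_ord_recr/= lerDl exprn_ge0.
(* [r] is summable: by [SG] its partial sums [S] are bounded. *)
have r_cvg0 : r @ \oo --> 0.
  apply: cvg_series_cvg_0; apply: nondecreasing_is_cvgn.
    by apply: nondecreasing_series => m _ _; exact: r0.
  (* The bound comes from dropping [r k >= 0] in [SG] and replacing [G k] by its limit. *)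
  exists (x * (y / (1 - y)) / (1 - x)) => _ [k _ <-].
  rewrite seriesEord -/(S k) ler_pdivlMr ?subr_gt0// mulrC SG.
  by rewrite (@le_trans _ _ (x * G k)) ?gerBl// ler_wpM2l.
rewrite -[X in X @ _]/S.
have -> : S = (fun k => (1 - x)^-1 * (x * G k - r k)).
  by apply/funext => k; rewrite -SG mulKf// subr_eq0 gt_eqF.
have -> : x / (1 - x) * (y / (1 - y)) = (1 - x)^-1 * (x * (y / (1 - y)) - 0).
  by rewrite subr0; ring.
apply: cvgMl_tmp; apply: cvgB => //; exact: cvgMl_tmp.
Qed.

End limits.

(** * Sparsity and the limits of mean and variance *)

Theorem proposition2 (R : realType) (d : measure_display) (T : measurableType d)
    (P : probability T R) (n : nat) (hn : (1 <= n)%N) (mu tau : R)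
    (htau : 0 < tau) (Q : 'M[R]_n) (hQ : correlation_matrix Q)
    (u : nat -> {RV P >-> n.-tuple R}) (z : 'I_n -> nat -> {RV P >-> bool})
    (hZ : sIBP mu tau Q u z) (i : 'I_n) :
  let d1 := delta mu tau 1 in
  let d2 := delta mu tau 2 in
  [/\ P [set w | z i k w = true] @[k --> \oo] --> 0%E,
      ('E_P[feature_count z i k])%E @[k --> \oo] --> (d1 / (1 - d1))%:E &
      ('V_P[feature_count z i k])%E @[k --> \oo] -->
        (d1 / (1 - d1) * (1 + 2 * d2 / (1 - d2) - d1 / (1 - d1)))%:E].
Proof.
move=> d1 d2.
have d1_01 : 0 <= d1 < 1 by rewrite delta_ge0 delta_lt1.
have d2_01 : 0 <= d2 < 1 by rewrite delta_ge0 delta_lt1.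
have cd1 := cvg_sum_exprS d1_01.
split.
- rewrite [X in X @ _](_ : _ = EFin \o geometric d1 d1); last first.
    by apply/funext => k /=; rewrite -exprS; exact: (prob_feature htau hQ hZ).
  apply: cvg_EFin; first exact: nearW.
  by apply: cvg_geometric; case/andP: d1_01 => *; rewrite ger0_norm.
- under eq_cvg do rewrite (expectation_feature_count htau hQ hZ).
  by apply: cvg_EFin; first exact: nearW.
- under eq_cvg do rewrite (variance_feature_count htau hQ hZ).
  apply: cvg_EFin; first exact: nearW.
  (* The target is expanded to match the variance term by term: mean, twice the convolution, minus
     the squared mean. *)
  rewrite [X in _ --> X](_ : _ = d1 / (1 - d1) +
    2 * (d1 / (1 - d1) * (d2 / (1 - d2))) - (d1 / (1 - d1)) ^+ 2); last by ring.
  apply: cvgB; last by rewrite expr2; exact: cvgM.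
  apply: cvgD => //; apply: cvgMl_tmp; exact: cvg_sum_convolution.
Qed.
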